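(* Let $t>1$ and run the RM-Algorithm with parameter $t$ on servers $S$ and requests $r_1,\dots,r_n$ ($|S|=n$) in a metric space with metric $d$. For any request $r_i$, if $P_i$ is a short augmenting path, then $s_i$ is a $\left(4+\frac{4}{t-1}\right)$-approximate nearest free server of $r_i$, i.e. $$d(r_i,s_i)\le\Big(4+\frac{4}{t-1}\Big)\min_{s\in S_F^i}d(r_i,s).$$
   Context: Given a matching $M^*$ between servers and requests, a vertex not matched by $M^*$ is free; an augmenting path with respect to $M^*$ is a simple path between two free vertices whose edges alternate between edges not in $M^*$ and edges in $M^*$. The $t$-net-cost of an augmenting path $P$ with respect to $M^*$ is $$\phi_t(P)=t\sum_{(s,r)\in P\setminus M^*}d(s,r)-\sum_{(s,r)\in P\cap M^*}d(s,r),$$ and its length is $\ell(P)=\sum_{(s,r)\in P}d(s,r)$. RM-Algorithm (parameter $t$): it maintains an online matching $M$ and an offline matching $M^*$, both initially empty. When request $r_i$ arrives (phase $i$), with $M^*_{i-1}$ the current offline matching: (1) compute an augmenting path $P_i$ of minimum $t$-net-cost with respect to $M^*_{i-1}$, starting at $r_i$ and ending at some free server $s_i$ (ties are broken in favour of fewest edges); (2) set $M^*_i=M^*_{i-1}\oplus P_i$ (symmetric difference) and add $(s_i,r_i)$ to $M$. $S_F^i$ is the set of servers that are free at the start of phase $i$ (the same for $M$ and $M^*$). $P_i$ is called short if $\ell(P_i)\le\frac{4}{t-1}\phi_t(P_i)$, where $\phi_t(P_i)$ is taken with respect to $M^*_{i-1}$. *)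

(* Defs.v *)
From HB Require Import structures.
From mathcomp Require Import all_boot all_order all_algebra.
From mathcomp Require Import reals metric_structure.

Set Implicit Arguments.
Unset Strict Implicit.
Unset Printing Implicit Defensive.

Import Order.TTheory GRing.Theory Num.Theory.
Local Open Scope ring_scope.

Section Paths.
Variables (S Q : finType).

(* Vertices are labels, not points: servers and requests may share a
   location. The graph is the complete bipartite graph on S and Q; an edge is
   written (server, request) whichever way a path traverses it. *)
Definition vertex : finType := (S + Q)%type.
Definition edge : finType := (S * Q)%type.

Definition edge_between (u v : vertex) : option edge :=
  match u, v with
  | inl s, inr r | inr r, inl s => Some (s, r)
  | _, _ => None
  end.

Definition adjacent : rel vertex := fun u v => isSome (edge_between u v).

Definition free_vertex (M : {set edge}) (v : vertex) : bool :=
  match v with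
  | inl s => [forall r, (s, r) \notin M]
  | inr r => [forall s, (s, r) \notin M]
  end.

Definition free_servers (M : {set edge}) : {set S} :=
  [set s | free_vertex M (inl s)].

(* As in mathcomp's path.v, a path is given by its first vertex x and the
   sequence p of the vertices that follow; it has size p edges. *)
Definition edge_seq (x : vertex) (p : seq vertex) : seq edge :=
  pmap id (pairmap edge_between x p).

Definition path_edges (x : vertex) (p : seq vertex) : {set edge} :=
  [set:: edge_seq x p].

Definition augmenting (M : {set edge}) (x : vertex) (p : seq vertex) : bool :=
  [&& path adjacent x p, uniq (x :: p), x != last x p,
      free_vertex M x, free_vertex M (last x p)
    & sorted (fun e f => (e \in M) != (f \in M)) (edge_seq x p)].

Definition augmenting_to_server (M : {set edge}) (x : vertex)
    (p : seq vertex) (s : S) : bool :=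
  augmenting M x p && (last x p == inl s).

Definition symdiff (A B : {set edge}) : {set edge} :=
  (A :\: B) :|: (B :\: A).

End Paths.

Section RM.
Variables (R : realType) (X : metricType R) (S : finType) (n : nat).
Variables (sloc : S -> X) (rloc : 'I_n -> X).

Local Notation vtx := (vertex S 'I_n).
Local Notation edg := (edge S 'I_n).

Definition cost (e : edg) : R := mdist (sloc e.1) (rloc e.2).

Definition net_cost (t : R) (M : {set edg}) (x : vtx) (p : seq vtx) : R :=
  t * (\sum_(e in path_edges x p :\: M) cost e)
  - \sum_(e in path_edges x p :&: M) cost e.

Definition path_length (x : vtx) (p : seq vtx) : R :=
  \sum_(e in path_edges x p) cost e.

(* One admissible choice of the path from the request r to the server s:
   minimum net-cost, ties broken in favour of fewest edges. *)
Definition rm_choice (t : R) (M : {set edg}) (r : 'I_n) (p : seq vtx)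
    (s : S) : Prop :=
  augmenting_to_server M (inr r) p s /\
  forall (q : seq vtx) (s' : S), augmenting_to_server M (inr r) q s' ->
    net_cost t M (inr r) p <= net_cost t M (inr r) q /\
    (net_cost t M (inr r) q = net_cost t M (inr r) p -> (size p <= size q)%N).

(* Phases are numbered from 0: M i and Mstar i are the online and offline
   matchings at the start of the phase of the request i : 'I_n, i.e. after i
   requests have been served. Values beyond index n are unconstrained. The path
   chosen in phase i is (inr i) followed by P i, and srv i is its last vertex. *)
Record rm_run (t : R) (M Mstar : nat -> {set edg}) (P : 'I_n -> seq vtx)
    (srv : 'I_n -> S) : Prop := RMRun {
  rm_online0 : M 0%N = set0;
  rm_offline0 : Mstar 0%N = set0;
  rm_path : forall i : 'I_n, rm_choice t (Mstar i) i (P i) (srv i);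
  rm_offlineS : forall i : 'I_n,
    Mstar i.+1 = symdiff (Mstar i) (path_edges (inr i) (P i));
  rm_onlineS : forall i : 'I_n, M i.+1 = (srv i, i) |: M i
}.

Definition short_path (t : R) (M : {set edg}) (x : vtx) (p : seq vtx) : Prop :=
  path_length x p <= 4 / (t - 1) * net_cost t M x p.

(* Since s is itself in F, seeding the minimum with the distance to s leaves it
   equal to the minimum over F. *)
Definition approx_nearest (c : R) (F : {set S}) (x : X) (s : S) : Prop :=
  s \in F /\
  mdist x (sloc s) <=
    c * \big[Num.min/mdist x (sloc s)]_(s' in F) mdist x (sloc s').

End RM.

(* Main.v *)
(* A direct edge from r_i to a free server s is itself an augmenting path, of
   net-cost t d(r_i, s), hence phi_t(P_i) <= t d(r_i, s). Shortness and the
   triangle inequality along P_i give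
     d(r_i, s_i) <= l(P_i) <= 4 / (t - 1) phi_t(P_i) <= 4 t / (t - 1) d(r_i, s),
   and 4 t / (t - 1) = 4 + 4 / (t - 1). *)
Require Import Defs.
From mathcomp Require Import all_boot all_order all_algebra.
From mathcomp Require Import reals metric_structure.
From mathcomp Require Import ring.
Import Order.TTheory GRing.Theory Num.Theory.
Local Open Scope ring_scope.

Definition incident {S Q : finType} (e : edge S Q) (v : vertex S Q) : bool :=
  match v with inl s => e.1 == s | inr r => e.2 == r end.

Lemma incident_edge_between {S Q : finType} {u v w : vertex S Q}
    {e : edge S Q} :
  edge_between u v = Some e -> incident e w = (w == u) || (w == v).
Proof.
by case: u v w => [s|r] [s'|r'] [s''|r''] //= [<-];
  rewrite /eq_op /= ?orbF eq_sym.
Qed.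

Lemma edge_seq_cons {S Q : finType} {x y : vertex S Q} {e : edge S Q}
    (p : seq (vertex S Q)) :
  edge_between x y = Some e -> edge_seq x (y :: p) = e :: edge_seq y p.
Proof. by rewrite /edge_seq /= => ->. Qed.

(** Used contrapositively: a path that avoids a vertex traverses no edge incident to it. *)
Lemma edge_seq_mem {S Q : finType} {v x : vertex S Q}
    {p : seq (vertex S Q)} {e : edge S Q} :
  path (@adjacent S Q) x p -> e \in edge_seq x p -> incident e v ->
  v \in x :: p.
Proof.
elim: p x => [|y p IHp] x //= /andP[].
rewrite /adjacent; case xy: (edge_between x y) => [f|] // _ path_p.
rewrite (edge_seq_cons _ xy) inE => /predU1P[-> | e_p] e_v.
  by move: e_v; rewrite (incident_edge_between xy) !inE orbA => ->.
by rewrite inE (IHp _ path_p e_p e_v) orbT.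
Qed.

Definition vertex_loc {X S Q : Type} (sloc : S -> X) (rloc : Q -> X)
  (v : S + Q) : X := match v with inl s => sloc s | inr r => rloc r end.

Section Costs.
Context {R : realType} {X : metricType R} {S : finType} {n : nat}.
Context (sloc : S -> X) (rloc : 'I_n -> X).
Local Notation loc := (vertex_loc sloc rloc).

Lemma cost_edge_between {u v : vertex S 'I_n} {e : edge S 'I_n} :
  edge_between u v = Some e -> cost sloc rloc e = mdist (loc u) (loc v).
Proof. by case: u v => [s|r] [s'|r'] //= [<-]; rewrite /cost //= metric_sym. Qed.

(** Triangle inequality, one edge per induction step. Since [path_length] sums over a set, a
    repeated edge would count once; simplicity of the path lets the cost of the first edge be split
    off. *)
Lemma mdist_path_length {x : vertex S 'I_n} {p : seq (vertex S 'I_n)} :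
  path (@adjacent S 'I_n) x p -> uniq (x :: p) ->
  mdist (loc x) (loc (last x p)) <= path_length sloc rloc x p.
Proof.
elim: p x => [|y p IHp] x.
  by move=> _ _; rewrite mdistxx sumr_ge0 // => e _; exact: mdist_ge0.
rewrite /= => /andP[xy path_p] /andP[x_p uniq_p].
move: xy; rewrite /adjacent; case xy: (edge_between x y) => [e|] // _.
(* The edge [e] touches [x], which by simplicity is not a vertex of [y :: p]. *)
have e_p : e \notin path_edges y p.
  rewrite inE; apply: contra x_p => e_p; apply: (edge_seq_mem path_p e_p).
  by rewrite (incident_edge_between xy) eqxx.
have -> : path_length sloc rloc x (y :: p)
    = cost sloc rloc e + path_length sloc rloc y p.
  rewrite /path_length -big_setU1 //; apply: eq_bigl => f.
  by rewrite !inE (edge_seq_cons _ xy) inE.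
rewrite (cost_edge_between xy).
by apply: le_trans (metric_triangle _ (loc y) _) _; rewrite lerD2l IHp.
Qed.

Lemma augmenting_direct_edge {M : {set edge S 'I_n}} {r : 'I_n} {s : S} :
  free_vertex M (inr r) -> free_vertex M (inl s) ->
  augmenting_to_server M (inr r) [:: inl s] s.
Proof.
by move=> r_free s_free; rewrite /augmenting_to_server /augmenting r_free
  [last _ _]/= s_free eqxx.
Qed.

(** As [s] is free, the single edge lies outside [M], so the subtracted sum is empty. *)
Lemma net_cost_direct_edge (t : R) (M : {set edge S 'I_n}) (r : 'I_n) (s : S) :
  free_vertex M (inl s) ->
  net_cost sloc rloc t M (inr r) [:: inl s] = t * mdist (rloc r) (sloc s).
Proof.
move=> /forallP/(_ r) srM; rewrite /net_cost.
have -> : path_edges (inr r) [:: inl s] = [set (s, r)].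
  by apply/setP => e; rewrite !inE.
have disj : [disjoint [set (s, r)] & M] by rewrite disjoints1.
move: (disj); rewrite -setI_eq0 => /eqP ->; rewrite big_set0 subr0.
by rewrite (setDidPl disj) big_set1 /cost /= metric_sym.
Qed.

End Costs.

Theorem lemma1 (R : realType) (X : metricType R) (n : nat) (S : finType)
    (cardS : #|S| = n) (sloc : S -> X) (rloc : 'I_n -> X) (t : R) (t_gt1 : 1 < t)
    (M Mstar : nat -> {set edge S 'I_n}) (P : 'I_n -> seq (vertex S 'I_n))
    (srv : 'I_n -> S) (run : rm_run sloc rloc t M Mstar P srv) (i : 'I_n) :
  short_path sloc rloc t (Mstar i) (inr i) (P i) ->
  approx_nearest sloc (4 + 4 / (t - 1)) (free_servers (Mstar i))
    (rloc i) (srv i).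
Proof.
move=> short_P; have [aug_P min_P] := rm_path run i.
(* Freeness of request [i] and of [srv i] is read off the augmenting path itself, not from the
   history of the run. *)
have /andP[/and5P[path_P uniq_P _ i_free /andP[srv_free _]] /eqP lastP] := aug_P.
rewrite lastP in srv_free.
have srv_F : srv i \in free_servers (Mstar i) by rewrite inE.
have t1_gt0 : 0 < t - 1 by rewrite subr_gt0.
have bound s : s \in free_servers (Mstar i) ->
    mdist (rloc i) (sloc (srv i))
      <= (4 + 4 / (t - 1)) * mdist (rloc i) (sloc s).
  rewrite inE => s_free.
  have := mdist_path_length sloc rloc path_P uniq_P.
  rewrite lastP => /= /le_trans; apply; apply: le_trans short_P _.
  have -> : 4 + 4 / (t - 1) = 4 / (t - 1) * t by field; exact: lt0r_neq0.
  rewrite -[leRHS]mulrA ler_pM2l ?divr_gt0 //.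
  (* With the positive factor [4 / (t - 1)] cancelled, the right-hand side becomes the net-cost of a
     competitor in the choice of [P i]. *)
  rewrite -(net_cost_direct_edge sloc rloc t (Mstar i)) //.
  exact: (min_P _ _ (augmenting_direct_edge i_free s_free)).1.
(* The seed of the minimum is the distance to [srv i], itself a free server, so [bound] covers the
   seed as well as the entries. *)
split=> //; elim/big_ind: _ => [|x y x_ge y_ge|s s_F]; try exact: bound.
by rewrite minEle; case: ifP.
Qed.
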